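(* Let $n_0<n_1<n_2<\cdots$ be a strictly increasing sequence of non-negative integers and let $\nu=\prod_{j=0}^{+\infty}|P_{n_j}|^2$ be the corresponding generalized Riesz product. Then $$\int_{\mathbb{T}}\sqrt{\frac{d\nu}{dz}}\,dz<1.$$
   Context: $\mathbb{T}$ is the unit circle and $dz$ denotes its normalized Lebesgue measure. Fix integers $m_k\in\{2,3,4,\dots\}$ ($k\ge0$) and non-negative integers $a_j^{(k)}$ ($1\le j\le m_k$, $k\ge0$), and set $h_0=1$, $h_{k+1}=m_kh_k+\sum_{j=1}^{m_k}a_j^{(k)}$, $$P_k(z)=\frac1{\sqrt{m_k}}\sum_{j=0}^{m_k-1}z^{jh_k+s(k,j)},\qquad s(k,0)=0,\quad s(k,j)=\sum_{i=1}^{j}a_i^{(k)}.$$ The generalized Riesz product $\nu=\prod_{j\ge0}|P_{n_j}|^2$ is the weak-* limit, as $N\to\infty$, of the probability measures $\prod_{j=0}^{N}|P_{n_j}(z)|^2\,dz$ on $\mathbb{T}$ (the limit exists). $\frac{d\nu}{dz}$ denotes the density of the absolutely continuous part of $\nu$ in its Lebesgue decomposition with respect to $dz$. *)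

(* Defs.v *)
From HB Require Import structures.
From mathcomp Require Import all_boot all_order all_algebra.
From mathcomp Require Import all_classical all_reals all_analysis.
From mathcomp Require Import measurable_realfun complex.

Set Implicit Arguments.
Unset Strict Implicit.
Unset Printing Implicit Defensive.

Import Order.TTheory GRing.Theory Num.Theory.
Import numFieldNormedType.Exports.

Local Open Scope classical_set_scope.
Local Open Scope ring_scope.
Local Open Scope complex_scope.

(* [R[i]] gets its norm topology only through the ascription to
   [numFieldType]. *)
Definition unit_circle (R : realType) : set (R[i] : numFieldType) :=
  [set z | `|z| = 1].

(* Subspace topology of the complex plane and the corresponding Borel
   sigma-algebra. *)
Definition circle (R : realType) := set_type (@unit_circle R).

HB.instance Definition _ (R : realType) := Topological.on (circle R).

Lemma unit_circle1 (R : realType) : (1 : R[i]) \in @unit_circle R.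
Proof. by apply/mem_set; rewrite /unit_circle /= normr1. Qed.

HB.instance Definition _ (R : realType) :=
  isPointed.Build (circle R) (exist _ (1 : R[i]) (unit_circle1 R)).

HB.instance Definition _ (R : realType) :=
  Measurable.copy (circle R) (g_sigma_algebraType (@open (circle R))).

Lemma unit_circle_cos_sin (R : realType) (t : R) :
  (cos t +i* sin t : R[i]) \in @unit_circle R.
Proof.
by apply/mem_set; rewrite /unit_circle /= normc_def /= cos2Dsin2 sqrtr1.
Qed.

(* t |-> exp (2 i pi t) *)
Definition circle_exp (R : realType) (t : measurableTypeR R) : circle R :=
  exist _ (cos (2 * pi * t) +i* sin (2 * pi * t))
    (unit_circle_cos_sin (2 * pi * t)).

Lemma continuous_real_complex (R : realType) :
  continuous (real_complex R : R -> (R[i] : numFieldType)).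
Proof.
move=> x; apply/(@cvgrPdist_lt (R[i] : numFieldType) (R[i] : numFieldType)).
move=> e e0.
have /andP[/eqP ie re] : (complex.Im e == 0) && (0 < complex.Re e).
  by move: e0; rewrite ltcE /=.
change (\forall y \near x, `|x%:C - y%:C| < e); near=> y.
have xy : `|x - y| < complex.Re e.
  by near: y; move: (complex.Re e) re; apply/cvgrPdist_lt; exact: cvg_id.
rewrite -rmorphB /= normc_def /= expr0n /= addr0 sqrtr_sqr.
by rewrite ltcE /= ie eqxx.
Unshelve. all: by end_near. Qed.

Lemma continuous_circle_exp (R : realType) : continuous (@circle_exp R).
Proof.
apply: continuous_comp_initial.
have -> : set_val \o @circle_exp R =
    (fun t => (cos (2 * pi * t))%:C + 'i * (sin (2 * pi * t))%:C).
  by apply/funext => t /=; rewrite set_valE /= [LHS]complexE.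
move=> t.
have ct : {for t, continuous (fun t : R => 2 * pi * t)}.
  by apply: cvgM; [exact: cvg_cst|exact: cvg_id].
apply: (@cvgD (R[i] : numFieldType) (R[i] : numFieldType)).
  apply: (@continuous_comp _ _ _ (fun t : R => cos (2 * pi * t))).
    by apply: continuous_comp => //; exact: continuous_cos.
  exact: continuous_real_complex.
apply: (@cvgM (R[i] : numFieldType)); first exact: cvg_cst.
apply: (@continuous_comp _ _ _ (fun t : R => sin (2 * pi * t))).
  by apply: continuous_comp => //; exact: continuous_sin.
exact: continuous_real_complex.
Qed.

Lemma measurable_circle_exp (R : realType) :
  measurable_fun [set: measurableTypeR R] (@circle_exp R).
Proof.
apply: (@measurability _ _ _ (circle R) _ _ (@open (circle R))) => // _ [A oA <-].
rewrite setTI; apply: open_measurable.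
have /continuousP := @continuous_circle_exp R; exact.
Qed.

HB.instance Definition _ (R : realType) :=
  isMeasurableFun.Build _ _ (measurableTypeR R) (circle R) (@circle_exp R)
    (@measurable_circle_exp R).

(* normalized Lebesgue measure *)
Definition circle_lebesgue (R : realType) : probability (circle R) R :=
  distribution (uniform_prob (@ltr01 R)) (@circle_exp R).

Section riesz_product.
Variables (m : nat -> nat) (a : nat -> nat -> nat).

Fixpoint riesz_height (k : nat) : nat :=
  if k is k'.+1 then
    (m k' * riesz_height k' + \sum_(1 <= j < (m k').+1) a k' j)%N
  else 1%N.

Definition riesz_shift (k j : nat) : nat := (\sum_(1 <= i < j.+1) a k i)%N.

Definition riesz_poly (R : realType) (k : nat) (z : R[i]) : R[i] :=
  ((Num.sqrt (m k)%:R)^-1)%:C *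
  \sum_(0 <= j < m k) z ^+ (j * riesz_height k + riesz_shift k j).

Definition riesz_density (R : realType) (n : nat -> nat) (N : nat)
    (z : circle R) : R :=
  \prod_(0 <= j < N.+1) Normc.normc (riesz_poly (n j) (val z)) ^+ 2.

(* weak-* convergence of [riesz_density n N] dz to [nu], tested against C(T);
   as all the measures are real, real-valued test functions are enough *)
Definition is_riesz_product (R : realType) (n : nat -> nat)
    (nu : {finite_measure set (circle R) -> \bar R}) : Prop :=
  forall f : circle R -> R, continuous f ->
    \int[@circle_lebesgue R]_z (f z * riesz_density n N z)
      @[N --> \oo] --> \int[nu]_z f z.

End riesz_product.

Definition mutually_singular d (T : measurableType d) (R : realType)
    (mu nu : set T -> \bar R) : Prop :=
  exists A : set T, [/\ measurable A, mu A = 0%E & nu (~` A) = 0%E].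

Definition lebesgue_decomposition d (T : measurableType d) (R : realType)
    (nu mu nua nus : set T -> \bar R) : Prop :=
  [/\ forall A, measurable A -> nu A = (nua A + nus A)%E,
      nua `<< mu & mutually_singular nus mu].

(* Main.v *)
Require Import Defs.
From mathcomp Require Import all_boot all_order all_algebra.
From mathcomp Require Import all_classical all_reals all_analysis.
From mathcomp Require Import measurable_realfun complex ring lra zify.

(* Since nu has mass 1, Cauchy-Schwarz bounds the integral by 1, and equality
   forces the density to be 1 almost everywhere, which leaves no mass to the
   singular part: nu would be the Lebesgue measure.  This is excluded by one
   Fourier coefficient.  The product of the polynomials P_(n j), j <= N, is a
   normalized sum of z^x over a finite set S of exponents (the gaps of P_k
   exceed the degrees of the previous factors, so exponents do not collide),
   hence the d-th Fourier coefficient of the N-th density is the proportion of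
   x in S such that d + x is in S.  For d the first positive exponent of
   P_(n 0) it is at least 1 / m (n 0) for every N, and so for nu. *)

Set Implicit Arguments.
Unset Strict Implicit.
Unset Printing Implicit Defensive.

Import Order.TTheory GRing.Theory Num.Theory.
Import numFieldNormedType.Exports.

(** * Combinatorics of the exponents *)

Section exponents.
Local Open Scope nat_scope.

(** The [d]-th Fourier coefficient of the squared modulus of the exponential sum over [s], before
    normalization; repeated entries count with multiplicity. *)
Definition diff_count (s : seq nat) (d : nat) : nat :=
  \sum_(x <- s) \sum_(y <- s) (d + x == y).

Definition sumset (s t : seq nat) : seq nat := [seq x + y | x <- s, y <- t].

Lemma diff_count0 (s : seq nat) : uniq s -> diff_count s 0 = size s.
Proof.
move=> us; rewrite -sum1_size /diff_count; apply: eq_big_seq => x xs.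
by rewrite (bigD1_seq x)//= eqxx big1// => y /negPf; rewrite eq_sym add0n => ->.
Qed.

(** A pair of [s] at distance [d] stays at distance [d] when both entries are translated by the same
    element of [t]. *)
Lemma diff_count_sumset (s t : seq nat) (d : nat) :
  diff_count s d * size t <= diff_count (sumset s t) d.
Proof.
rewrite /diff_count big_allpairs_dep/= big_distrl/=.
apply: leq_sum => x _; rewrite mulnC -sum1_size big_distrl/= big_seq [leqRHS]big_seq.
apply: leq_sum => g gt; rewrite mul1n big_allpairs_dep/=.
(* Among the sums [y + h] with [h] in [t], only [h = g] is kept. *)
apply: leq_sum => y _; rewrite (big_rem g)//= addnA eqn_add2r.
exact: leq_addr.
Qed.

Section spectrum.
Variables (m : nat -> nat) (a : nat -> nat -> nat).

Definition riesz_freq (k j : nat) : nat := j * riesz_height m a k + riesz_shift a k j.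

Definition riesz_block (k : nat) : seq nat := [seq riesz_freq k j | j <- iota 0 (m k)].

Fixpoint riesz_spectrum (n : nat -> nat) (N : nat) : seq nat :=
  if N is N'.+1 then sumset (riesz_spectrum n N') (riesz_block (n N))
  else riesz_block (n 0).

Lemma riesz_freq0 k : riesz_freq k 0 = 0.
Proof. by rewrite /riesz_freq /riesz_shift mul0n big_geq. Qed.

Lemma riesz_freqS k j :
  riesz_freq k j + riesz_height m a k <= riesz_freq k j.+1.
Proof.
rewrite /riesz_freq /riesz_shift [in leqRHS]big_nat_recr//= mulSn.
lia.
Qed.

Lemma riesz_freq_gap k i j : i < j ->
  riesz_freq k i + riesz_height m a k <= riesz_freq k j.
Proof.
elim: j => // j IH; rewrite ltnS leq_eqVlt => /predU1P[->|/IH h].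
  exact: riesz_freqS.
have := riesz_freqS k j; lia.
Qed.

(** By conversion, [riesz_freq k (m k)] is [riesz_height m a k.+1], so this is the gap inequality
    with upper index [m k], one past the last exponent of the block. *)
Lemma riesz_freq_height k j : j < m k ->
  riesz_freq k j + riesz_height m a k <= riesz_height m a k.+1.
Proof. by move=> jm; exact: (@riesz_freq_gap k j (m k) jm). Qed.

Hypothesis m_ge2 : forall k, 2 <= m k.

Lemma riesz_height_gt0 k : 0 < riesz_height m a k.
Proof.
elim: k => //= k IH; rewrite addn_gt0 muln_gt0 IH (leq_trans _ (m_ge2 k))//.
Qed.

Lemma riesz_height_homo : {homo riesz_height m a : i j / i <= j}.
Proof.
apply: homo_leq => //; first exact: leq_trans.
move=> k /=; apply: leq_trans (leq_addr _ _).
by rewrite leq_pmull// (leq_trans _ (m_ge2 k)).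
Qed.

Local Arguments riesz_height : simpl never.

Variable n : nat -> nat.
Hypothesis n_incr : {homo n : i j / i < j}.

(** A block at level [k] stops at least [riesz_height m a k] below the next height. As [n] increases
    strictly, the sums built from earlier factors are below [riesz_height m a (n N)], so they fit in
    that margin. *)
Lemma riesz_spectrum_lt N x : x \in riesz_spectrum n N ->
  x < riesz_height m a (n N).+1.
Proof.
have block k y : y \in riesz_block k ->
    y + riesz_height m a k <= riesz_height m a k.+1.
  by case/mapP => j; rewrite mem_iota add0n => /andP[_ jm] ->; exact: riesz_freq_height.
elim: N x => [|N IH] x /=.
  by move/block; have := riesz_height_gt0 (n 0); lia.
case/allpairsP => -[y z] /= [/IH hy /block hz ->].
have := riesz_height_homo (n_incr (ltnSn N)); lia.
Qed.

(** Distinct exponents of the new block are at least [riesz_height m a (n N.+1)] apart, which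
    exceeds every earlier exponent; a sum therefore determines its two terms. *)
Lemma riesz_spectrum_uniq N : uniq (riesz_spectrum n N).
Proof.
have injf k : injective (riesz_freq k).
  move=> i j e; have := @riesz_freq_gap k i j; have := @riesz_freq_gap k j i.
  by have := riesz_height_gt0 k; rewrite e; lia.
have ub k : uniq (riesz_block k) by rewrite map_inj_uniq ?iota_uniq.
elim: N => [|N IH]; first exact: ub.
apply: allpairs_uniq => // -[x y] [x' y'].
move=> /allpairsP[[u v] [/= hu hv [-> ->]]] /allpairsP[[u' v'] [/= hu' hv' [-> ->]]].
have := riesz_height_homo (n_incr (ltnSn N)).
case/mapP: hv => i _ ->; case/mapP: hv' => j _ ->.
move: (riesz_spectrum_lt hu) (riesz_spectrum_lt hu').
have := @riesz_freq_gap (n N.+1) i j; have := @riesz_freq_gap (n N.+1) j i.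
move=> h1 h2 h3 h4 h5 e.
have ij : i = j by lia.
by subst j; congr pair; lia.
Qed.

Lemma riesz_spectrum_size N :
  size (riesz_spectrum n N) = \prod_(0 <= j < N.+1) m (n j).
Proof.
elim: N => [|N IH]; first by rewrite big_nat1 /= size_map size_iota.
by rewrite big_nat_recr//= size_allpairs IH size_map size_iota.
Qed.

(** In the first block the pair formed by 0 and [riesz_freq (n 0) 1] gives the proportion
    [1 / m (n 0)], and [diff_count_sumset] shows that adding a block does not lower the
    proportion. *)
Lemma riesz_spectrum_diff N :
  size (riesz_spectrum n N) <= m (n 0) * diff_count (riesz_spectrum n N) (riesz_freq (n 0) 1).
Proof.
elim: N => [|N IH].
  rewrite /= size_map size_iota leq_pmulr// /diff_count.
  rewrite (bigD1_seq 0)//=; last 2 first.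
  - by apply/mapP; exists 0; rewrite ?riesz_freq0// mem_iota add0n (leq_trans _ (m_ge2 _)).
  - exact: (@riesz_spectrum_uniq 0).
  rewrite (bigD1_seq (riesz_freq (n 0) 1))//= ?addn0 ?eqxx//; last first.
    exact: (@riesz_spectrum_uniq 0).
  by apply/mapP; exists 1; rewrite // mem_iota add0n m_ge2.
rewrite /= size_allpairs.
apply: (leq_trans (leq_mul IH (leqnn _))).
by rewrite -mulnA leq_mul2l diff_count_sumset orbT.
Qed.

End spectrum.

End exponents.

Local Open Scope classical_set_scope.
Local Open Scope ring_scope.

(** * Orthogonality of the cosines on the unit interval *)

Section trigonometric_integrals.
Variable R : realType.
Local Notation leb := (@lebesgue_measure R).

Lemma continuous_cos_mul (c : R) : continuous (fun t : R => cos (c * t)).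
Proof.
move=> t; apply: (@continuous_comp _ _ _ (fun t : R => c * t)).
  exact: mulrl_continuous.
exact: continuous_cos.
Qed.

Lemma sin_nat_2pi (k : nat) : sin (k%:R * (2 * pi)) = 0 :> R.
Proof.
rewrite -[RHS](@sin0 R) -(periodicn (@sinD2pi R) k 0) add0r.
by congr sin; rewrite -mulr_natl mulr2n; ring.
Qed.

(** For distinct frequencies the antiderivative [sin (c * t) / c] vanishes at both ends. The
    difference of [p] and [q] is taken in [R], since subtraction in [nat] truncates. *)
Lemma integral_cos_freq (p q : nat) :
  (\int[leb]_(t in `[0%R, 1%R])
    (cos (p%:R * (2 * pi * t) - q%:R * (2 * pi * t)))%:E)%E = (p == q)%:R%:E.
Proof.
pose c : R := (p%:R - q%:R) * (2 * pi).
have cE t : p%:R * (2 * pi * t) - q%:R * (2 * pi * t) = c * t by rewrite /c; ring.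
under eq_integral do rewrite cE.
have [pq|pq] := eqVneq p q.
  have c0 : c = 0 by rewrite /c pq subrr mul0r.
  under eq_integral do rewrite c0 mul0r cos0.
  by rewrite integral_cst//= lebesgue_measure_itv/= lte01 oppr0 adde0 mule1.
have c0 : c != 0.
  by rewrite mulf_neq0 ?subr_eq0 ?eqr_nat// mulf_neq0// ?pnatr_eq0// gt_eqF// pi_gt0.
have dF (t : R) : is_derive t 1 (fun t : R => sin (c * t) / c) (cos (c * t)).
  apply: is_derive_eq; rewrite /GRing.scale/=.
  by field.
have cF : continuous (fun t : R => sin (c * t) / c).
  by move=> t; apply/differentiable_continuous/derivable1_diffP; case: (dF t).
rewrite (@continuous_FTC2 _ _ (fun t => sin (c * t) / c))//.
- rewrite mulr1 mulr0 sin0 mul0r sube0 /c mulrBl sinB !sin_nat_2pi.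
  by rewrite mul0r mulr0 subr0 mul0r.
- by apply: continuous_subspaceT; exact: continuous_cos_mul.
- split.
  + by move=> x _; case: (dF x).
  + by apply: cvg_at_right_filter; exact: cF.
  + by apply: cvg_at_left_filter; exact: cF.
- by move=> x _; rewrite derive1E derive_val.
Qed.

Lemma integrable_cos_freq (p q : nat) :
  leb.-integrable `[0, 1]
    (fun t => (cos (p%:R * (2 * pi * t) - q%:R * (2 * pi * t)))%:E).
Proof.
apply: continuous_compact_integrable; first exact: segment_compact.
apply: continuous_subspaceT.
rewrite (_ : (fun t => _) = fun t => cos ((p%:R - q%:R) * (2 * pi) * t)).
  exact: continuous_cos_mul.
by apply/funext => t; congr cos; ring.
Qed.

End trigonometric_integrals.

(** * Continuous functions on the circle and trigonometric expansions *)

Section circle.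
Local Open Scope complex_scope.

Lemma continuous_norm_le (R : realType) (f : R[i] -> R) :
  {morph f : z w / z - w} -> (forall z, `|f z|%:C <= `|z|) ->
  continuous (f : (R[i] : numFieldType) -> R).
Proof.
move=> fB fle z.
pose K : numFieldType := R[i]; pose F := nbhs (z : K).
have FF : ProperFilter F by exact: (@nbhs_pfilter K z).
change (f w @[w --> F] --> f z).
apply/cvgrPdist_lt => e e0; near=> w.
have : `|z - w| < e%:C.
  near: w; have : 0 < e%:C by rewrite ltcR.
  move: (e%:C); apply/(@cvgrPdist_lt (R[i] : numFieldType) (R[i] : numFieldType)).
  exact: cvg_id.
by move=> h; rewrite -ltcR -fB; exact: le_lt_trans h.
Unshelve. all: by end_near. Qed.

Lemma continuous_Re (R : realType) :
  continuous (@complex.Re R : (R[i] : numFieldType) -> R).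
Proof.
apply: continuous_norm_le; last exact: normc_ge_Re.
by case=> ? ? [? ?].
Qed.

Lemma continuous_Im (R : realType) :
  continuous (@complex.Im R : (R[i] : numFieldType) -> R).
Proof.
apply: continuous_norm_le; first by case=> ? ? [? ?].
(* Up to sign, the imaginary part is the real part after multiplication by the imaginary unit, which
   preserves the modulus. *)
move=> z; rewrite -(normrN (complex.Im z)) -ReiNIm.
apply: (le_trans (normc_ge_Re _)).
by rewrite normrM [X in _ * X]normc_def /= expr0n expr1n add0r sqrtr1 mulr1.
Qed.

Section circle_power.
Variable R : realType.

(** The two claims go through one induction, because each coordinate of a product involves both
    coordinates of the factors. *)
Lemma continuous_circle_Re_Im_exp (k : nat) :
  continuous (fun z : circle R => complex.Re (val z ^+ k)) /\
  continuous (fun z : circle R => complex.Im (val z ^+ k)).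
Proof.
have cv : continuous (val : circle R -> (R[i] : numFieldType)).
  exact: initial_continuous.
elim: k => [|k [IHr IHi]]; first by split=> z; exact: cst_continuous.
have cr : continuous (fun z : circle R => complex.Re (val z)).
  by move=> z; apply: continuous_comp; [exact: cv|exact: continuous_Re].
have ci : continuous (fun z : circle R => complex.Im (val z)).
  by move=> z; apply: continuous_comp; [exact: cv|exact: continuous_Im].
split=> z.
- rewrite (_ : (fun _ => _) = (fun z : circle R =>
    complex.Re (val z) * complex.Re (val z ^+ k)
    - complex.Im (val z) * complex.Im (val z ^+ k))); last first.
    apply/funext => w; rewrite exprS.
    by case: (val w) (val w ^+ k) => ? ? [? ?].
  exact: cvgB (cvgM (cr z) (IHr z)) (cvgM (ci z) (IHi z)).
- rewrite (_ : (fun _ => _) = (fun z : circle R =>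
    complex.Re (val z) * complex.Im (val z ^+ k)
    + complex.Im (val z) * complex.Re (val z ^+ k))); last first.
    apply/funext => w; rewrite exprS.
    by case: (val w) (val w ^+ k) => ? ? [? ?].
  exact: cvgD (cvgM (cr z) (IHi z)) (cvgM (ci z) (IHr z)).
Qed.

Lemma normc_sqr (z : R[i]) :
  Normc.normc z ^+ 2 = complex.Re z ^+ 2 + complex.Im z ^+ 2.
Proof. by case: z => x y /=; rewrite sqr_sqrtr// addr_ge0// sqr_ge0. Qed.

Lemma Re_sum (I : Type) (r : seq I) (F : I -> R[i]) :
  complex.Re (\sum_(i <- r) F i) = \sum_(i <- r) complex.Re (F i).
Proof. by apply: (big_morph (@complex.Re R)) => // -[? ?] []. Qed.

Lemma Im_sum (I : Type) (r : seq I) (F : I -> R[i]) :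
  complex.Im (\sum_(i <- r) F i) = \sum_(i <- r) complex.Im (F i).
Proof. by apply: (big_morph (@complex.Im R)) => // -[? ?] []. Qed.

Lemma continuous_sum (T : topologicalType) (I : Type) (r : seq I)
    (F : I -> T -> R) : (forall i, continuous (F i)) ->
  continuous (fun z => \sum_(i <- r) F i z).
Proof.
move=> cF; elim: r => [|i r IH] z.
  by under eq_fun do rewrite big_nil; exact: cst_continuous.
by under eq_fun do rewrite big_cons; apply: cvgD; [exact: cF|exact: IH].
Qed.

Lemma circle_expX (t : R) (k : nat) : val (circle_exp t) ^+ k =
  cos (k%:R * (2 * pi * t)) +i* sin (k%:R * (2 * pi * t)).
Proof.
elim: k => [|k IH]; first by rewrite !mul0r cos0 sin0.
rewrite exprS IH /=; move: (2 * pi * t) => x.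
rewrite -natr1 mulrDl mul1r cosD sinD.
by apply/eqP; rewrite eq_complex /=; apply/andP; split; apply/eqP; ring.
Qed.

Lemma measurable_continuous_circle (f : circle R -> R) : continuous f ->
  measurable_fun [set: circle R] f.
Proof.
move=> /continuousP cf.
apply: (measurability _ (RGenOpens.measurableE R)) => _ [_ [a [b ->]] <-].
rewrite setTI; apply: sub_sigma_algebra; apply: cf; exact: interval_open.
Qed.


Definition trig_density (s : seq nat) (z : circle R) : R :=
  Normc.normc (\sum_(k <- s) val z ^+ k) ^+ 2.

(* The test functions are shifted by 1 to be nonnegative. *)
Definition one_plus_cos (d : nat) (z : circle R) : R := 1 + complex.Re (val z ^+ d).

Lemma continuous_one_plus_cos d : continuous (one_plus_cos d).
Proof.
move=> z; have [c _] := continuous_circle_Re_Im_exp d.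
exact: cvgD (@cst_continuous (circle R) R 1 z) (c z).
Qed.

Lemma continuous_trig_density s : continuous (trig_density s).
Proof.
rewrite (_ : trig_density s = fun z => (\sum_(k <- s) complex.Re (val z ^+ k)) ^+ 2
  + (\sum_(k <- s) complex.Im (val z ^+ k)) ^+ 2); last first.
  by apply/funext => z; rewrite /trig_density normc_sqr Re_sum Im_sum.
have c1 := @continuous_sum (circle R) _ s (fun k z => complex.Re (val z ^+ k))
  (fun k => (continuous_circle_Re_Im_exp k).1).
have c2 := @continuous_sum (circle R) _ s (fun k z => complex.Im (val z ^+ k))
  (fun k => (continuous_circle_Re_Im_exp k).2).
by move=> z; exact: cvgD (cvgM (c1 z) (c1 z)) (cvgM (c2 z) (c2 z)).
Qed.

Lemma one_plus_cos_ge0 d z : 0 <= one_plus_cos d z.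
Proof.
rewrite /one_plus_cos -lerBlDl sub0r.
have : `|complex.Re (val z ^+ d)|%:C <= 1%:C.
  apply: (le_trans (normc_ge_Re _)).
  by rewrite normrX; have /set_mem -> := valP z; rewrite expr1n.
by rewrite lecR ler_norml => /andP[].
Qed.

(** The squared modulus is the double sum of the cosines of [p - q]; multiplying by the cosine of
    frequency [d] splits each into two halves. The frequencies are written [d + p] and [d + q] so
    that they remain natural numbers, as in [integral_cos_freq]. *)
Lemma one_plus_cos_trig_density s d t :
  one_plus_cos d (circle_exp t) * trig_density s (circle_exp t) =
  \sum_(p <- s) \sum_(q <- s)
    (cos (p%:R * (2 * pi * t) - q%:R * (2 * pi * t)) +
     2^-1 * cos ((d + p)%:R * (2 * pi * t) - q%:R * (2 * pi * t)) +
     2^-1 * cos ((d + q)%:R * (2 * pi * t) - p%:R * (2 * pi * t))).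
Proof.
rewrite /one_plus_cos /trig_density normc_sqr Re_sum Im_sum.
under eq_bigr do rewrite circle_expX /=.
under [X in _ + X ^+ 2]eq_bigr do rewrite circle_expX /=.
rewrite circle_expX /=; move: (2 * pi * t) => x.
rewrite !expr2 !big_distrlr/= -big_split/= big_distrr/=; apply: eq_bigr => p _.
rewrite -big_split/= big_distrr/=; apply: eq_bigr => q _.
rewrite !natrD !mulrDl !cosB !cosD !sinD; by field.
Qed.

End circle_power.

(** * Integration against the normalized Lebesgue measure of the circle *)

Section integrals.
Variable R : realType.
Local Notation mu := (@circle_lebesgue R).

Lemma integral_circle_lebesgue (f : circle R -> R) : continuous f ->
  (forall z, 0 <= f z) ->
  (\int[mu]_z (f z)%:E =
   \int[@lebesgue_measure R]_(t in `[0%R, 1%R]) (f (circle_exp t))%:E)%E.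
Proof.
move=> cf f0; have mf := measurable_continuous_circle cf.
rewrite ge0_integral_pushforward//; last 2 first.
- exact/measurable_EFinP.
- by move=> z _; rewrite lee_fin.
rewrite preimage_setT integral_uniform//.
- by rewrite subr0 invr1 mul1e.
- by apply/measurable_EFinP; exact: measurableT_comp.
- by move=> t; rewrite lee_fin.
Qed.

(** By orthogonality each cosine contributes 1 exactly when its two frequencies agree: the first
    family counts [p = q], the two halves count [d + p = q] and [d + q = p]. *)
Lemma integral_trig_density (s : seq nat) (d : nat) (c : R) : 0 <= c ->
  \int[mu]_z (one_plus_cos d z * (c * trig_density s z)) =
  c * (diff_count s 0 + diff_count s d)%:R.
Proof.
move=> c0.
have cF : continuous (fun z : circle R => one_plus_cos d z * trig_density s z).
  by move=> z; exact: cvgM (@continuous_one_plus_cos R d z) (@continuous_trig_density R s z).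
have F0 (z : circle R) : 0 <= one_plus_cos d z * trig_density s z.
  by rewrite mulr_ge0// ?one_plus_cos_ge0// sqr_ge0.
rewrite /Rintegral.
under eq_integral do rewrite mulrCA EFinM.
rewrite ge0_integralZl//; last first.
- by move=> z _; rewrite lee_fin.
- by apply/measurable_EFinP; exact: measurable_continuous_circle.
rewrite integral_circle_lebesgue//.
under eq_integral do rewrite one_plus_cos_trig_density.
pose u p q t : R := cos (p%:R * (2 * pi * t) - q%:R * (2 * pi * t)).
have iu p q : lebesgue_measure.-integrable `[0%R, 1%R] (fun t => (u p q t)%:E).
  exact: integrable_cos_freq.
(* The summand of [one_plus_cos_trig_density], written with extended real operations so that
   linearity of the integral applies term by term. *)
pose w p q t : \bar R :=
  ((u p q t)%:E + 2^-1%:E * (u (d + p)%N q t)%:E + 2^-1%:E * (u (d + q)%N p t)%:E)%E.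
have iw p q : lebesgue_measure.-integrable `[0%R, 1%R] (w p q).
  by rewrite /w; apply: integrableD => //; [apply: integrableD => //|]; exact: integrableZl.
rewrite (_ : (\int[_]_(_ in _) _)%E = (\int[lebesgue_measure]_(t in `[0%R, 1%R])
    \sum_(p <- s) \sum_(q <- s) w p q t)%E); last first.
  apply: eq_integral => t _; rewrite -sumEFin; apply: eq_bigr => p _.
  by rewrite -sumEFin.
rewrite integral_sum//; last by move=> p; exact: integrable_sum.
under eq_bigr => p _.
  rewrite integral_sum//.
  under eq_bigr => q _.
    rewrite integralD//; last 2 first.
    - by apply: integrableD => //; exact: integrableZl.
    - exact: integrableZl.
    rewrite integralD//; last exact: integrableZl.
    rewrite !integralZl// !integral_cos_freq -!EFinM -!EFinD.
    over.
  rewrite sumEFin; over.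
rewrite sumEFin -EFinM /=; congr (c * _).
have dE e : (diff_count s e)%:R = \sum_(p <- s) \sum_(q <- s) (e + p == q)%N%:R :> R.
  by rewrite natr_sum; apply: eq_bigr => p _; rewrite natr_sum.
under eq_bigr do rewrite !big_split/= -!big_distrr/=.
rewrite !big_split/= -!big_distrr/= -dE -(dE 0).
(* Exchanging [p] and [q] identifies the two halves, which add up to one full count. *)
rewrite [X in _ + 2^-1 * X](_ : _ = (diff_count s d)%:R); last first.
  by rewrite exchange_big dE.
by rewrite natrD; field.
Qed.

End integrals.

(** * Fourier coefficients of the generalized Riesz product *)

Section density.
Variables (R : realType) (m : nat -> nat) (a : nat -> nat -> nat).
Hypothesis m_ge2 : forall k, (2 <= m k)%N.

(** [sumset] keeps repeated sums, so it lists exactly the terms of the expanded product of the two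
    exponential sums. *)
Lemma trig_density_sumset (s t : seq nat) (z : circle R) :
  trig_density (sumset s t) z = trig_density s z * trig_density t z.
Proof.
rewrite /trig_density -exprMn -Normc.normcM big_distrlr/= big_allpairs_dep/=.
by congr (Normc.normc _ ^+ 2); apply: eq_bigr => x _; apply: eq_bigr => y _; rewrite exprD.
Qed.

Lemma normc_riesz_poly (k : nat) (z : circle R) :
  Normc.normc (riesz_poly m a k (val z)) ^+ 2 =
  (m k)%:R^-1 * trig_density (riesz_block m a k) z.
Proof.
rewrite /riesz_poly Normc.normcM exprMn /trig_density big_map /index_iota subn0.
congr (_ * _); rewrite /= expr0n addr0 sqrtr_sqr normfV exprVn.
by rewrite ger0_norm ?sqrtr_ge0// sqr_sqrtr.
Qed.

Lemma riesz_density_spectrum (n : nat -> nat) (N : nat) (z : circle R) :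
  riesz_density m a n N z = (size (riesz_spectrum m a n N))%:R^-1 *
    trig_density (riesz_spectrum m a n N) z.
Proof.
rewrite riesz_spectrum_size /riesz_density.
elim: N => [|N IH]; first by rewrite !big_nat1 normc_riesz_poly.
rewrite big_nat_recr//= IH normc_riesz_poly trig_density_sumset.
by rewrite [in RHS]big_nat_recr//= natrM invfM; ring.
Qed.

Variable n : nat -> nat.
Hypothesis n_incr : {homo n : i j / (i < j)%N}.

Lemma size_riesz_spectrum_gt0 N : (0 < size (riesz_spectrum m a n N))%N.
Proof. by rewrite riesz_spectrum_size; apply: prodn_gt0 => j; apply: leq_trans (m_ge2 _). Qed.

Lemma integral_riesz_density (d N : nat) :
  \int[@circle_lebesgue R]_z (one_plus_cos d z * riesz_density m a n N z) =
  1 + (diff_count (riesz_spectrum m a n N) d)%:R /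
      (size (riesz_spectrum m a n N))%:R.
Proof.
under eq_Rintegral do rewrite riesz_density_spectrum.
rewrite integral_trig_density ?invr_ge0// diff_count0; last exact: riesz_spectrum_uniq.
rewrite natrD mulrDr mulVf 1?mulrC// pnatr_eq0 -lt0n.
exact: size_riesz_spectrum_gt0.
Qed.

Variable nu : {finite_measure set (circle R) -> \bar R}.
Hypothesis nu_riesz : is_riesz_product m a n nu.

(** For [d = 0] the test function is the constant 2, and its integral against each partial product
    is [1 + 1], since no exponent is repeated. *)
Lemma riesz_product_mass : nu setT = 1%E.
Proof.
have nuT : nu setT \is a fin_num by exact: fin_num_measure.
have : \int[nu]_z one_plus_cos 0%N z = 2 * fine (nu setT).
  rewrite -Rintegral_cst//; apply: eq_Rintegral.
have /cvg_lim <-// := nu_riesz (@continuous_one_plus_cos R 0%N).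
under eq_fun do rewrite integral_riesz_density diff_count0 ?riesz_spectrum_uniq//
  divff ?pnatr_eq0 -?lt0n ?size_riesz_spectrum_gt0//.
rewrite lim_cst// => h; rewrite -[LHS]fineK//; congr EFin; lra.
Qed.

Lemma riesz_product_neq_lebesgue :
  ~ (forall A, measurable A -> nu A = @circle_lebesgue R A).
Proof.
move=> nuE; pose d := riesz_freq m a (n 0%N) 1%N.
have d0 : (0 < d)%N.
  have := @riesz_freq_gap m a (n 0%N) 0%N 1%N isT.
  by have := @riesz_height_gt0 m a m_ge2 (n 0%N); rewrite /d; lia.
have : \int[nu]_z one_plus_cos d z = 1.
  (* The constant density 1 is the one attached to the single exponent 0, so [integral_trig_density]
     also computes the Lebesgue integral; its [d]-th count is 0 because [d] is positive. *)
  transitivity (\int[@circle_lebesgue R]_z (one_plus_cos d z * (1 * trig_density [:: 0%N] z))).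
    rewrite /Rintegral (@eq_measure_integral _ _ _ _ (@circle_lebesgue R) nu); last first.
      by move=> A mA _; exact: nuE.
    congr fine; apply: eq_integral => z _; congr EFin.
    by rewrite /trig_density big_seq1 expr0 Normc.normc1 expr1n !mulr1.
  rewrite integral_trig_density// mul1r /diff_count !big_seq1 addn0 eqxx.
  by rewrite gtn_eqF// addn0.
apply/eqP; rewrite gt_eqF//.
have m0 : 0 < (m (n 0%N))%:R :> R by rewrite ltr0n (leq_trans _ (m_ge2 _)).
(* This lower bound holds for every partial product with a constant independent of [N], so it
   survives the weak-* limit. *)
apply: (@lt_le_trans _ _ (1 + (m (n 0%N))%:R^-1)); first by rewrite ltrDl invr_gt0.
apply: (cvgr_to_ge (nu_riesz (@continuous_one_plus_cos R d))).
apply: nearW => N; rewrite integral_riesz_density lerD2l.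
rewrite ler_pdivlMr ?ltr0n ?size_riesz_spectrum_gt0// mulrC ler_pdivrMr//.
by rewrite -natrM ler_nat mulnC riesz_spectrum_diff.
Qed.

End density.

End circle.

(** * The equality case of Cauchy-Schwarz and the Lebesgue decomposition *)

Local Open Scope ereal_scope.
Local Open Scope charge_scope.

(** With [s] the square root of [f], the integral of [(s - 1) ^+ 2] is that of [f] plus 1 minus
    twice that of [s], hence at most 0; so [s] is 1 almost everywhere. *)
Lemma ae_eq1_integral_sqrte d (T : measurableType d) (R : realType)
    (mu : probability T R) (f : T -> \bar R) :
  (forall x, 0 <= f x) -> (forall x, f x \is a fin_num) ->
  measurable_fun setT f -> \int[mu]_x f x <= 1 ->
  1 <= \int[mu]_x sqrte (f x) -> ae_eq mu setT f (cst 1).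
Proof.
move=> f0 ffin mf intf le1.
pose g x := fine (f x).
have fE x : f x = (g x)%:E by rewrite /g fineK.
have g0 x : (0 <= g x)%R by rewrite -lee_fin -fE.
have mg : measurable_fun setT g by exact: measurableT_comp.
pose s x := Num.sqrt (g x).
have s2 x : (s x ^+ 2 = g x)%R by rewrite sqr_sqrtr.
have s0 x : (0 <= s x)%R by exact: sqrtr_ge0.
have ms : measurable_fun setT s.
  by apply: measurableT_comp => //; apply: continuous_measurable_fun; exact: sqrt_continuous.
have mD : measurable_fun setT (fun x => (s x - 1) ^+ 2)%R.
  by apply: measurable_funX; apply: measurable_funB.
have sE x : sqrte (f x) = (s x)%:E by rewrite fE.
(* The square is expanded with the cross term moved to the left, so that only nonnegative functions
   are integrated and no extended real subtraction occurs. *)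
have key : \int[mu]_x ((s x - 1) ^+ 2)%:E + 2%:E * \int[mu]_x (s x)%:E
    = \int[mu]_x f x + 1.
  rewrite -ge0_integralZl//; last 2 first.
  - exact/measurable_EFinP.
  - by move=> x _; rewrite lee_fin.
  have <- : \int[mu]_x (cst 1 x) = 1.
    by rewrite integral_cst// mul1e; exact: probability_setT.
  rewrite -!ge0_integralD//; first last.
  - by apply: measurable_funeM; exact/measurable_EFinP.
  - by move=> x _; rewrite -EFinM lee_fin mulr_ge0.
  - exact/measurable_EFinP.
  - by move=> x _; rewrite lee_fin sqr_ge0.
  apply: eq_integral => x _ /=.
  by rewrite fE -EFinM -!EFinD -s2; congr EFin; ring.
have D0 : \int[mu]_x ((s x - 1) ^+ 2)%:E = 0.
  apply/eqP; rewrite eq_le integral_ge0 ?andbT//; last first.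
    by move=> x _; rewrite lee_fin sqr_ge0.
  have : \int[mu]_x ((s x - 1) ^+ 2)%:E + 2%:E <= 2%:E.
    rewrite [leRHS](_ : _ = 1 + 1); last by rewrite -EFinD.
    apply: (le_trans _ (leeD intf (lexx 1))); rewrite -key leeD2l//.
    under eq_integral do rewrite -sE.
    by rewrite -[leLHS]mule1 lee_pmul2l.
  by rewrite -[leRHS]add0e leeD2rE.
have /(ae_eq_integral_abs mu measurableT) : \int[mu]_x `|((s x - 1) ^+ 2)%:E| = 0.
  rewrite -[RHS]D0; apply: eq_integral => x _.
  by rewrite gee0_abs// lee_fin sqr_ge0.
move=> /(_ ((measurable_EFinP _ _).2 mD)).
apply: filterS => x /(_ I) [/eqP]; rewrite sqrf_eq0 subr_eq0 => /eqP s1 _.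
by rewrite fE -s2 s1 expr1n.
Qed.

(** The density of [nua] is 1 almost everywhere, so [nua] is [mu] and already carries the whole mass
    of [nu]. *)
Lemma eq_integral_sqrt_density d (T : measurableType d) (R : realType)
    (mu : probability T R) (nu nua nus : {finite_measure set T -> \bar R}) :
  lebesgue_decomposition nu mu nua nus -> nu setT = 1 ->
  1 <= \int[mu]_z sqrte (('d (charge_of_finite_measure nua) '/d mu) z) ->
  forall A, measurable A -> nu A = mu A.
Proof.
move=> [nuE dom _] nu1 le1.
(* A version of the density that is nonnegative and finite at every point, as
   [ae_eq1_integral_sqrte] requires; [aef] links it to the Radon-Nikodym derivative. *)
pose f := Radon_Nikodym_SigmaFinite.f nua mu.
have f0 : forall x, 0 <= f x by exact: Radon_Nikodym_SigmaFinite.f_ge0.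
have ffin : forall x, f x \is a fin_num by exact: Radon_Nikodym_SigmaFinite.f_fin_num.
have fint : mu.-integrable setT f by exact: Radon_Nikodym_SigmaFinite.f_integrable.
have fE A : measurable A -> nua A = \int[mu]_(x in A) f x.
  by move=> mA; exact: Radon_Nikodym_SigmaFinite.f_integral.
have mf := measurable_int _ fint.
have msqrt (h : T -> \bar R) : (forall x, h x \is a fin_num) -> measurable_fun setT h ->
    measurable_fun setT (fun x => sqrte (h x)).
  move=> hfin mh.
  rewrite (_ : (fun x => _) = EFin \o (Num.sqrt \o (fine \o h))); last first.
    by apply/funext => x /=; rewrite -{1}(fineK (hfin x)).
  apply: measurableT_comp => //; apply: measurableT_comp; last exact: measurableT_comp.
  by apply: continuous_measurable_fun; exact: sqrt_continuous.
have aef : ae_eq mu setT f ('d (charge_of_finite_measure nua) '/d mu).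
  exact: ae_eq_Radon_Nikodym_SigmaFinite.
have nua1 : nua setT <= 1 by rewrite -nu1 nuE// leeDl.
have f1 : ae_eq mu setT f (cst 1).
  apply: ae_eq1_integral_sqrte => //.
    by rewrite -fE.
  apply: (le_trans le1); rewrite le_eqVlt; apply/orP; left; apply/eqP.
  apply/esym/ae_eq_integral => //.
  - exact: msqrt.
  - apply: msqrt; first by move=> x; exact: Radon_Nikodym_fin_num.
    exact: (measurable_int _ (Radon_Nikodym_integrable _)).
  - by apply: filterS aef => x h _; rewrite h.
have nuaE A : measurable A -> nua A = mu A.
  move=> mA; rewrite fE//.
  rewrite (ae_eq_integral (cst 1))//; last 2 first.
  - exact: measurable_funTS.
  - by apply: filterS f1 => x h _; exact: h.
  by rewrite integral_cst// mul1e.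
(* Both [nu] and [nua] have total mass 1, and the finite mass of [nus] is their difference. *)
have nus0 : nus setT = 0.
  have := nuE _ measurableT; rewrite nu1 nuaE// probability_setT.
  have := fin_num_measure nus _ measurableT.
  case: (nus setT) => // r _ /esym/eqP.
  by rewrite -EFinD eqe -subr_eq0 addrAC subrr add0r => /eqP ->.
move=> A mA; rewrite nuE// nuaE// [nus A](_ : _ = 0) ?adde0//.
by apply/eqP; rewrite eq_le measure_ge0 andbT -nus0 le_measure// inE.
Qed.

Theorem theorem3p3 (R : realType) (m : nat -> nat) (a : nat -> nat -> nat)
  (m_ge2 : forall k, (2 <= m k)%N)
  (n : nat -> nat) (n_incr : {homo n : i j / (i < j)%N})
  (nu : {finite_measure set (circle R) -> \bar R})
  (nu_riesz : is_riesz_product m a n nu)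
  (nua nus : {finite_measure set (circle R) -> \bar R})
  (nu_decomp : lebesgue_decomposition nu (@circle_lebesgue R) nua nus) :
  \int[@circle_lebesgue R]_z
    sqrte (('d (charge_of_finite_measure nua) '/d (@circle_lebesgue R)) z) < 1.
Proof.
rewrite ltNge; apply/negP => le1.
apply: (riesz_product_neq_lebesgue m_ge2 n_incr nu_riesz).
apply: eq_integral_sqrt_density nu_decomp _ le1.
exact: riesz_product_mass nu_riesz.
Qed.
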